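(* Let $\overline{f}:\mathbb{R}^n\to\mathbb{R}$ be differentiable with $\overline{L}$-Lipschitz continuous gradient, $\overline{L}>0$ (not necessarily convex), let $r_1:\mathbb{R}^n\to\mathbb{R}\cup\{+\infty\}$ be proper, closed and convex, and denote $\overline{F}(x):=\overline{f}(x)+r_1(x)$. Let $x_*$ be a minimizer of $\overline{F}$. Consider the iteration, started from some $x_0$, $$x_{k+1}=\operatorname{prox}_{\alpha r_1}\bigl(x_k-\alpha(\nabla\overline{f}(x_k)+e_k)\bigr),\qquad k=0,1,2,\ldots,$$ with stepsize $\alpha=1/\overline{L}$ and with errors $e_k\in\mathbb{R}^n$ obeying $\|e_k\|\le C\|x_{k+1}-x_k\|$ for all $k$, where $C<\overline{L}/2$ is a constant. Then for every $n\ge 1$ (number of iterations) the iterates satisfy $$\min_{k\in\{0,1,\ldots,n-1\}}\|x_{k+1}-x_k\|\le A\sqrt{\frac{\overline{F}(x_0)-\overline{F}(x_* )}{n}},\qquad A=\sqrt{\frac{2}{\overline{L}-2C}}.$$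
   Context: $\|\cdot\|$ is the Euclidean norm. For a function $g$ and $\alpha>0$ the proximity operator is $$\operatorname{prox}_{\alpha g}(z)=\operatorname{arg\,min}_x\ \tfrac{1}{2\alpha}\|x-z\|^2+g(x).$$ The number of iterations $n$ in the conclusion is unrelated to the dimension of the ambient space $\mathbb{R}^n$. (In the paper's application, $\overline{f}$ is a projected function $\overline f(x)=\min_y f(x,y)+r_2(y)$ with Lipschitz gradient.) *)

(* Defs.v *)
From HB Require Import structures.
From mathcomp Require Import all_boot all_order all_algebra.
From mathcomp Require Import all_classical all_reals all_analysis.

Set Implicit Arguments.
Unset Strict Implicit.
Unset Printing Implicit Defensive.

Import Order.TTheory GRing.Theory Num.Theory.
Import numFieldNormedType.Exports.

Local Open Scope classical_set_scope.
Local Open Scope ring_scope.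

(* The Euclidean norm.  The library norm `|x| on 'rV[R]_n is the sup norm; the
   two are equivalent, so the library's topology and differentiability on
   'rV[R]_n agree with the Euclidean ones. *)
Definition enorm (R : realType) (n : nat) (x : 'rV[R]_n) : R :=
  Num.sqrt (\sum_(i < n) x ord0 i ^+ 2).

(* The vector of partial derivatives; meaningful where f is differentiable. *)
Definition grad (R : realType) (n : nat) (f : 'rV[R]_n -> R) (x : 'rV[R]_n) :
    'rV[R]_n :=
  \row_(i < n) 'D_(delta_mx ord0 i) f x.

Definition epigraph (R : realType) (T : Type) (g : T -> \bar R) : set (T * R) :=
  [set p | (g p.1 <= p.2%:E)%E].

(* Excluding -oo makes this the class of proper functions into R \cup {+oo}. *)
Definition proper_fun (R : realType) (T : Type) (g : T -> \bar R) : Prop :=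
  (forall x, g x != -oo%E) /\ (exists x, (g x < +oo)%E).

Definition closed_fun (R : realType) (n : nat) (g : 'rV[R]_n -> \bar R) : Prop :=
  closed (epigraph g).

(* Intended for functions that do not take the value -oo, so that the right-hand
   side is never of the form +oo - oo; the convention 0 * +oo = 0 makes the
   inequality harmless at t = 0 and t = 1. *)
Definition convex_fun (R : realType) (n : nat) (g : 'rV[R]_n -> \bar R) : Prop :=
  forall (x y : 'rV[R]_n) (t : R), 0 <= t <= 1 ->
    (g (t *: x + (1 - t) *: y)%R <= t%:E * g x + (1 - t)%:E * g y)%E.

Definition argmin (R : realType) (T : Type) (g : T -> \bar R) : set T :=
  [set x | forall y, (g x <= g y)%E].

(* As a set: for g proper, closed and convex and alpha > 0 it is a singleton, and
   z' = prox_{alpha g}(z) is then rendered by prox alpha g z z'. *)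
Definition prox (R : realType) (n : nat) (alpha : R) (g : 'rV[R]_n -> \bar R)
    (z : 'rV[R]_n) : set 'rV[R]_n :=
  argmin (fun x => ((1 / (2 * alpha) * enorm (x - z) ^+ 2)%:E + g x)%E).

(* Main.v *)
(* Write d = x_{k+1} - x_k.  Optimality of the proximal step with step 1/L gives
   r1(x_{k+1}) <= r1(x_k) - L |d|^2 - <grad f(x_k) + e_k, d>, and the descent
   lemma gives f(x_{k+1}) <= f(x_k) + <grad f(x_k), d> + (L/2) |d|^2.  Since
   |<e_k, d>| <= C |d|^2, summing yields
   F(x_{k+1}) + (L/2 - C) |d|^2 <= F(x_k), which telescopes. *)
Require Import Defs.
From HB Require Import structures.
From mathcomp Require Import all_boot all_order all_algebra.
From mathcomp Require Import all_classical all_reals all_analysis.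
From mathcomp Require Import ring lra.
Import Order.TTheory GRing.Theory Num.Theory.
Import numFieldNormedType.Exports.
Local Open Scope classical_set_scope.
Local Open Scope ring_scope.

(** * Euclidean inner product and norm *)

Definition dot {R : realType} {n : nat} (u v : 'rV[R]_n) : R :=
  \sum_(i < n) u ord0 i * v ord0 i.

Lemma enorm_ge0 {R : realType} {n : nat} (u : 'rV[R]_n) : 0 <= enorm u.
Proof. exact: sqrtr_ge0. Qed.

Lemma enorm_sqr {R : realType} {n : nat} (u : 'rV[R]_n) :
  enorm u ^+ 2 = dot u u.
Proof.
rewrite sqr_sqrtr; last by apply: sumr_ge0 => i _; exact: sqr_ge0.
by apply: eq_bigr => i _; rewrite expr2.
Qed.

Lemma dotC {R : realType} {n : nat} (u v : 'rV[R]_n) : dot u v = dot v u.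
Proof. by apply: eq_bigr => i _; rewrite mulrC. Qed.

Lemma dotDl {R : realType} {n : nat} (u v w : 'rV[R]_n) :
  dot (u + v) w = dot u w + dot v w.
Proof. by rewrite /dot -big_split; apply: eq_bigr => i _; rewrite mxE mulrDl. Qed.

Lemma dotZl {R : realType} {n : nat} (a : R) (u w : 'rV[R]_n) :
  dot (a *: u) w = a * dot u w.
Proof. by rewrite /dot mulr_sumr; apply: eq_bigr => i _; rewrite mxE mulrA. Qed.

Lemma dotDr {R : realType} {n : nat} (u v w : 'rV[R]_n) :
  dot w (u + v) = dot w u + dot w v.
Proof. by rewrite !(dotC w) dotDl. Qed.

Lemma dotZr {R : realType} {n : nat} (a : R) (u w : 'rV[R]_n) :
  dot w (a *: u) = a * dot w u.
Proof. by rewrite !(dotC w) dotZl. Qed.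

Lemma dotNl {R : realType} {n : nat} (u w : 'rV[R]_n) :
  dot (- u) w = - dot u w.
Proof. by rewrite -scaleN1r dotZl mulN1r. Qed.

Lemma dotNr {R : realType} {n : nat} (u w : 'rV[R]_n) :
  dot w (- u) = - dot w u.
Proof. by rewrite !(dotC w) dotNl. Qed.

Lemma enormZ {R : realType} {n : nat} (a : R) (u : 'rV[R]_n) :
  0 <= a -> enorm (a *: u) = a * enorm u.
Proof.
move=> a0; apply/eqP.
rewrite -(eqrXn2 (n := 2)) ?mulr_ge0 ?enorm_ge0//.
by rewrite exprMn !enorm_sqr dotZl dotZr mulrA expr2.
Qed.

Lemma enormN {R : realType} {n : nat} (u : 'rV[R]_n) : enorm (- u) = enorm u.
Proof.
apply/eqP; rewrite -(eqrXn2 (n := 2)) ?enorm_ge0//.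
by rewrite !enorm_sqr dotNl dotNr opprK.
Qed.

Lemma enorm_sqrD {R : realType} {n : nat} (u v : 'rV[R]_n) :
  enorm (u + v) ^+ 2 = enorm u ^+ 2 + 2 * dot u v + enorm v ^+ 2.
Proof. by rewrite !enorm_sqr dotDl !dotDr (dotC v u); ring. Qed.

Lemma dot0l {R : realType} {n : nat} (u : 'rV[R]_n) : dot 0 u = 0.
Proof. by rewrite -(scale0r 0) dotZl mul0r. Qed.

Lemma enorm_eq0 {R : realType} {n : nat} (u : 'rV[R]_n) :
  (enorm u == 0) = (u == 0).
Proof.
apply/eqP/eqP => [u0|->]; last by apply/eqP; rewrite -sqrf_eq0 enorm_sqr dot0l.
have /psumr_eq0P h : \sum_(i < n) u ord0 i ^+ 2 = 0.
  transitivity (enorm u ^+ 2); last by rewrite u0 expr0n.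
  by rewrite enorm_sqr; apply: eq_bigr => i _; rewrite expr2.
apply/rowP => i; rewrite mxE; apply/eqP; rewrite -sqrf_eq0.
by rewrite h// => j _; exact: sqr_ge0.
Qed.

(** Cauchy-Schwarz: the square of the norm of [|v| u - |u| v] equals [2 |u| |v| (|u| |v| - <u, v>)].
    Zero vectors are split off so that the factor [|u| |v|] can be cancelled. *)
Lemma dot_le_enorm {R : realType} {n : nat} (u v : 'rV[R]_n) :
  dot u v <= enorm u * enorm v.
Proof.
have [->|u0] := eqVneq u 0; first by rewrite dot0l mulr_ge0 ?enorm_ge0.
have [->|v0] := eqVneq v 0; first by rewrite dotC dot0l mulr_ge0 ?enorm_ge0.
have : 0 <= enorm (enorm v *: u - enorm u *: v) ^+ 2 by exact: sqr_ge0.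
rewrite enorm_sqr !(dotDl, dotDr, dotNl, dotNr, dotZl, dotZr) (dotC v u).
rewrite -!enorm_sqr => h.
have : 0 <= enorm u * enorm v * (enorm u * enorm v - dot u v) by nra.
rewrite pmulr_rge0 ?subr_ge0//.
by rewrite mulr_gt0// lt_neqAle eq_sym enorm_eq0 ?u0 ?v0 enorm_ge0.
Qed.

(** * Derivatives along lines and the descent inequality *)

Lemma deriveE_dot_grad {R : realType} {n : nat} (f : 'rV[R]_n -> R) (x d : 'rV[R]_n) :
  differentiable f x -> 'D_d f x = dot (grad f x) d.
Proof.
move=> df; rewrite deriveE// {1}[d]row_sum_delta linear_sum.
by apply: eq_bigr => i _; rewrite linearZ /= mxE deriveE// mulrC.
Qed.

Lemma is_derive_line {R : realType} {n : nat} (f : 'rV[R]_n -> R)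
    (x d : 'rV[R]_n) (t : R) :
  differentiable f (x + t *: d) ->
  is_derive t 1 (fun s => f (x + s *: d)) (dot (grad f (x + t *: d)) d).
Proof.
move=> df.
(* The difference quotient of the restriction to the line is literally the one defining the
   directional derivative of [f] at [x + t *: d]. *)
have E : (fun h : R => h^-1 *: (((fun s => f (x + s *: d)) \o shift t) (h *: 1)
                                - f (x + t *: d))) =
    (fun h : R => h^-1 *: ((f \o shift (x + t *: d)) (h *: d) -
                           f (x + t *: d))).
  apply/funext => h /=; congr (_ *: (f _ - _)).
  by rewrite [h *: 1]mulr1 scalerDl addrCA.
apply: DeriveDef; first by rewrite /derivable E; exact: diff_derivable.
by rewrite /derive E -deriveE_dot_grad.
Qed.

Lemma ler_of_perturbation {R : realType} (a b k : R) : 0 <= k ->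
  (forall t, 0 < t <= 1 -> a <= b + t * k) -> a <= b.
Proof.
move=> k0 h; apply/ler_addgt0Pr => e e0.
have ke : 0 < k + e by lra.
(* This [t] replaces the limit [t -> 0]: the denominator [k + e] gives both [t <= 1] and
   [t * k <= e], even when [k = 0]. *)
apply: (le_trans (h (e / (k + e)) _)).
  by rewrite divr_gt0//= ler_pdivrMr// mul1r lerDr.
by rewrite lerD2l mulrAC ler_pdivrMr// ler_pM2l// lerDl ltW.
Qed.

Lemma lipschitz_grad_descent {R : realType} {n : nat} {f : 'rV[R]_n -> R} {L : R}
    (f_diff : forall x, differentiable f x)
    (f_lip : forall x y, enorm (grad f x - grad f y) <= L * enorm (x - y))
    (x d : 'rV[R]_n) :
  f (x + d) <= f x + dot (grad f x) d + L / 2 * enorm d ^+ 2.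
Proof.
pose D := dot (grad f x) d; pose c := L / 2 * enorm d ^+ 2.
pose g : R -> R := (fun s : R => f (x + s *: d)) - (D *: id + c *: (id ^+ 2)).
pose g' (s : R) :=
  dot (grad f (x + s *: d)) d - (D + s * (L * enorm d ^+ 2)).
have dg (s : R) : is_derive s 1 g (g' s).
  have df := is_derive_line _ _ _ _ (f_diff (x + s *: d)).
  apply: is_derive_eq.
  by rewrite /g' /c /= /GRing.scale /= !mulr1 expr1; field.
have gE s : g s = f (x + s *: d) - (D * s + c * s ^+ 2) by [].
have : g 1 <= g 0.
  apply: (@ler0_derive1_le_cc R g 0 1); rewrite ?in_itv /= ?lexx ?ler01//.
  - move=> s; rewrite in_itv/= => /andP[s0 _].
    (* It remains to bound [<grad f (x + s d) - grad f x, d>] by [s L |d|^2], by Cauchy-Schwarz and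
       the Lipschitz condition. *)
    rewrite derive1E derive_val /g' opprD addrA -dotNl -dotDl subr_le0.
    apply: (le_trans (dot_le_enorm _ _)); rewrite expr2 !mulrA.
    apply: ler_wpM2r; first exact: enorm_ge0.
    apply: (le_trans (f_lip _ _)).
    by rewrite addrAC subrr add0r enormZ ?(ltW s0)// mulrCA mulrA.
  - by apply: derivable_within_continuous => s _.
rewrite !gE expr1n expr0n scale1r scale0r !mulr1 !mulr0 !addr0 subr0.
by rewrite lerBlDr addrA.
Qed.

(** * The proximal step and the decrease it yields *)

Lemma prox_fin_num {R : realType} {n : nat} {alpha : R}
    {g : 'rV[R]_n -> \bar R} {z p : 'rV[R]_n} :
  proper_fun g -> prox alpha g z p -> g p \is a fin_num.
Proof.
(* The objective at the minimizer [p] is at most its finite value at a point [w] of the domain. *)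
move=> [gN [w gw]] /(_ w); rewrite fin_numE gN /=.
by case: (g p) => //; case: (g w) gw.
Qed.

(* First-order optimality: [(z - p) / alpha] is a subgradient of [g] at [p].  It
   comes from comparing [p] with [p + t (y - p)] and letting [t] tend to [0]. *)
Lemma prox_subgradient {R : realType} {n : nat} {alpha : R}
    {g : 'rV[R]_n -> \bar R} {z p : 'rV[R]_n} :
  0 < alpha -> proper_fun g -> convex_fun g -> prox alpha g z p ->
  forall y, (g p <= (dot (p - z) (y - p) / alpha)%:E + g y)%E.
Proof.
move=> alpha0 g_proper g_convex pP y.
have := prox_fin_num g_proper pP; have [gN _] := g_proper.
case gp : (g p) => [a| |]// _.
case gy : (g y) => [b| |]; [|by rewrite addey ?leey|by have := gN y; rewrite gy].
rewrite -EFinD lee_fin.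
(* Moving from [p] by [t (y - p)] adds the quadratic term [t^2 E]; after division by [t] it is the
   vanishing perturbation [t E]. *)
pose E := enorm (y - p) ^+ 2 / (2 * alpha).
apply: (@ler_of_perturbation _ _ _ E).
  by rewrite divr_ge0 ?sqr_ge0// mulr_ge0// ltW.
move=> t /andP[t0 t1].
have t01 : 0 <= t <= 1 by rewrite (ltW t0).
have := pP (t *: y + (1 - t) *: p); have := g_convex y p t t01.
rewrite gp gy -!EFinM -EFinD.
have := gN (t *: y + (1 - t) *: p).
(* Convexity excludes [+oo] at the intermediate point, both ends being finite. *)
case: (g _) => [c| |]// _; rewrite -!EFinD !lee_fin => h1 h2.
have {h2} : a <= (2 * t * dot (p - z) (y - p) + t ^+ 2 * enorm (y - p) ^+ 2) /
                 (2 * alpha) + c.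
  have e : t *: y + (1 - t) *: p - z = (p - z) + t *: (y - p).
    by apply/rowP => i; rewrite !mxE; ring.
  move: h2; rewrite e enorm_sqrD dotZr enormZ ?(ltW t0)// => h2.
  rewrite -(lerD2l (1 / (2 * alpha) * enorm (p - z) ^+ 2)); apply: (le_trans h2).
  by rewrite le_eqVlt; apply/orP; left; apply/eqP; field; rewrite gt_eqF.
move=> h2; rewrite -(ler_pM2l t0).
have <- : (2 * t * dot (p - z) (y - p) + t ^+ 2 * enorm (y - p) ^+ 2) /
          (2 * alpha) + t * b
   = t * (dot (p - z) (y - p) / alpha + b + t * E).
  by rewrite /E; field; rewrite gt_eqF.
lra.
Qed.

Lemma prox_gradient_decrease {R : realType} {n : nat} {f : 'rV[R]_n -> R}
    {r : 'rV[R]_n -> \bar R} {L C : R}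
    (L_gt0 : 0 < L) (f_diff : forall x, differentiable f x)
    (f_lip : forall x y, enorm (grad f x - grad f y) <= L * enorm (x - y))
    (r_proper : proper_fun r) (r_convex : convex_fun r) (x y e : 'rV[R]_n) :
  prox (1 / L) r (x - (1 / L) *: (grad f x + e)) y ->
  enorm e <= C * enorm (y - x) ->
  ((f y + (L / 2 - C) * enorm (y - x) ^+ 2)%:E + r y <= (f x)%:E + r x)%E.
Proof.
move=> yP eC; have iL0 : 0 < 1 / L by rewrite divr_gt0.
have := prox_subgradient iL0 r_proper r_convex yP x.
have := prox_fin_num r_proper yP; have := r_proper.1 x.
case: (r y) => [b| |]//.
(* [r x] may be [+oo], as can happen at the starting point; the bound is then trivial. *)
case: (r x) => [a| |]// _ _; last by move=> _; rewrite addey// leey.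
rewrite -!EFinD !lee_fin.
have -> : y - (x - 1 / L *: (grad f x + e)) =
          (y - x) + (1 / L) *: (grad f x + e).
  by rewrite opprB addrA addrAC.
rewrite -(opprB y x) dotNr dotDl dotZl (dotDl (grad f x)) -enorm_sqr.
have := lipschitz_grad_descent f_diff f_lip x (y - x); rewrite addrC subrK.
(* The error term needs a lower bound on [<e, y - x>], hence the sign. *)
have := dot_le_enorm (- e) (y - x); rewrite dotNl enormN.
have : enorm e * enorm (y - x) <= C * enorm (y - x) ^+ 2.
  by rewrite expr2 mulrA ler_wpM2r ?enorm_ge0.
set d := enorm (y - x) ^+ 2; set q := dot e _; set p := dot _ _ => h1 h2 h3.
have -> : - (d + 1 / L * (p + q)) / (1 / L) = - (L * d) - p - q.
  by field; rewrite gt_eqF.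
lra.
Qed.

(** * Summation over the iterations *)

Theorem theorem2p5 (R : realType) (n : nat)
    (f : 'rV[R]_n -> R) (r1 : 'rV[R]_n -> \bar R) (L C : R)
    (L_gt0 : 0 < L)
    (f_diff : forall x, differentiable f x)
    (f_lip : forall x y, enorm (grad f x - grad f y) <= L * enorm (x - y))
    (r1_proper : proper_fun r1) (r1_closed : closed_fun r1)
    (r1_convex : convex_fun r1)
    (F : 'rV[R]_n -> \bar R) (F_def : forall x, F x = ((f x)%:E + r1 x)%E)
    (xstar : 'rV[R]_n) (xstar_min : argmin F xstar)
    (alpha : R) (alpha_def : alpha = 1 / L)
    (x e : nat -> 'rV[R]_n)
    (x_step : forall k,
       prox alpha r1 (x k - alpha *: (grad f (x k) + e k)) (x k.+1))
    (C_lt : C < L / 2)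
    (e_le : forall k, enorm (e k) <= C * enorm (x k.+1 - x k))
    (A : R) (A_def : A = Num.sqrt (2 / (L - 2 * C)))
    (N : nat) (N_ge1 : (1 <= N)%N) :
  (\big[mine/+oo]_(k < N) (enorm (x k.+1 - x k))%:E
     <= A%:E * sqrte ((F (x 0%N) - F xstar) / N%:R%:E))%E.
Proof.
subst alpha; have c0 : 0 < L / 2 - C by lra.
have c20 : 0 < 2 / (L - 2 * C) by rewrite divr_gt0//; lra.
have A0 : 0 < A by rewrite A_def sqrtr_gt0.
have N0 : 0 < N%:R :> R by rewrite ltr0n.
have FN y : F y != -oo%E by rewrite F_def; have := r1_proper.1 y; case: (r1 y).
(* Only from index 1 on are the iterates proximal points; [x 0] may lie outside the domain of
   [r1]. *)
have Fxfin k : F (x k.+1) \is a fin_num.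
  by rewrite F_def fin_numD /= (prox_fin_num r1_proper (x_step k)).
have Fstar : F xstar \is a fin_num.
  rewrite fin_numE FN /=; have := xstar_min (x 1%N); have := Fxfin 0%N.
  by case: (F (x 1%N)) => //; case: (F xstar).
have dec k : (((L / 2 - C) * enorm (x k.+1 - x k) ^+ 2)%:E + F (x k.+1) <=
              F (x k))%E.
  have := prox_gradient_decrease L_gt0 f_diff f_lip r1_proper r1_convex
            _ _ _ (x_step k) (e_le k).
  by rewrite -!F_def EFinD (addeC (f _)%:E) -addeA -F_def.
(* If [F (x 0)] is [+oo], so is the right-hand side, because [A > 0]. *)
have [Fx0|] := boolP (F (x 0%N) \is a fin_num); last first.
  rewrite fin_numE FN /= negbK => /eqP ->.
  rewrite -(fineK Fstar) /= inver gt_eqF// gt0_mulye ?lte_fin ?invr_gt0//=.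
  by rewrite gt0_muley ?lte_fin// leey.
pose phi k := fine (F (x k)).
have Fphi k : F (x k) = (phi k)%:E by rewrite /phi fineK//; case: k.
pose B := A * Num.sqrt ((phi 0%N - fine (F xstar)) / N%:R).
have star_le k : fine (F xstar) <= phi k by rewrite fine_le// Fphi.
have -> : (A%:E * sqrte ((F (x 0%N) - F xstar) / N%:R%:E))%E = B%:E.
  by rewrite Fphi -(fineK Fstar) /= inver gt_eqF.
(* If every step were longer than [B], each decrease of [phi] would exceed [(L / 2 - C) B^2]; the
   sum stays strict because [N >= 1]. *)
have [k kB] : exists k : 'I_N, enorm (x k.+1 - x k) <= B.
  apply: contrapT => /forallNP noB.
  have : \sum_(0 <= k < N) (L / 2 - C) * B ^+ 2 <
         \sum_(0 <= k < N) (phi k - phi k.+1).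
    apply: ltr_sum_nat => // k /= kN.
    have := dec k; rewrite !Fphi -EFinD lee_fin -lerBrDr; apply: lt_le_trans.
    rewrite ltr_pM2l// ltrXn2r//; last first.
      by have /negP := noB (Ordinal kN); rewrite -ltNge.
    by rewrite mulr_ge0 ?sqrtr_ge0// ltW.
  rewrite sumr_const_nat subn0 (telescope_sumr_eq (fun k => - phi k))//; last first.
    by move=> k _; rewrite opprK addrC.
  (* [A] is chosen so that [A^2] is the inverse of [L / 2 - C]. *)
  have -> : (L / 2 - C) * B ^+ 2 *+ N = phi 0%N - fine (F xstar).
    rewrite /B exprMn A_def !sqr_sqrtr ?(ltW c20) ?divr_ge0 ?subr_ge0// -mulr_natr.
    by field; rewrite gt_eqF//=; lra.
  (* The telescoped sum [phi 0 - phi N] cannot exceed [phi 0] minus the minimum. *)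
  have := star_le N; lra.
by apply: (le_trans (bigmin_le _ k _)); rewrite lee_fin.
Qed.
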